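(* Let $n\ge 1$ be an integer. If $R\in Q_{2n}$ is an odd and (strictly) increasing function on $[-1,1]$, then $$R'(0)\le \frac12\cdot 9^n\, R(1).$$
   Context: For a nonnegative integer $m$, $P_m$ denotes the space of all real algebraic polynomials of degree at most $m$, and $Q_m$ denotes the set of all rational functions $r=\frac pq$ with $p,q\in P_m$ ($q\not\equiv 0$) that are continuous on $[-1,1]$. *)

(* Defs.v *)
From HB Require Import structures.
From mathcomp Require Import all_boot all_order all_algebra.
From mathcomp Require Import all_classical all_reals all_analysis.

Set Implicit Arguments.
Unset Strict Implicit.
Unset Printing Implicit Defensive.

Import Order.TTheory GRing.Theory Num.Theory.
Import numFieldNormedType.Exports.

Local Open Scope classical_set_scope.
Local Open Scope ring_scope.

Definition poly_deg_le (R : realType) (m : nat) : set {poly R} :=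
  [set p | (size p <= m.+1)%N].

(* An element of Q_m is a function on [-1, 1], represented by a total function
   R -> R whose values outside [-1, 1] are unconstrained.  The equation
   f = p / q is required only where q does not vanish: p / q is a rational
   function, so p and q may have common zeros in [-1, 1], and the value of f
   there is the one given by continuity. *)
Definition rat_fun (R : realType) (m : nat) : set (R -> R) :=
  [set f : R -> R | {within `[-1, 1], continuous f} /\
     exists p q : {poly R},
       [/\ poly_deg_le m p, poly_deg_le m q, q != 0 &
           {in `[-1, 1], forall x, q.[x] != 0 -> f x = p.[x] / q.[x]}]].

(* Main.v *)
Require Import Defs.
From HB Require Import structures.
From mathcomp Require Import all_boot all_order all_algebra.
From mathcomp Require Import all_classical all_reals all_analysis.
From mathcomp Require Import lra ring.

(** The idea is to extract from a function violating the bound a positive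
    definite matrix of size [n.+1] that also has rank at most [n].

    Dividing out common factors and taking parity into account
    ([rat_fun_reduced], [odd_rat_funP]), [f x = x * A(x^2) / C(x^2)] on [-1, 1]
    with [A] of degree less than [n], [C] of degree at most [n] and positive on
    [0, 1]. Put [S = A / C] and [s = S(1) = f(1)]; then [f'(0) = S(0)], and the
    claim is [S(0) <= 9 ^+ n * s / 2].

    Suppose [S(0) > 9 ^+ n * s / 2]. By the intermediate value theorem there are
    nodes [t 1 < ... < t n = 1] with [S (t i) = 9 ^+ (n - i) * s]. That [f]
    increases means that [Num.sqrt x * S x] does, so multiplying the value by 9
    forces the node to be divided by at least 81 ([geometric_nodes]). Add the
    node [t 0 = 0] and consider the matrix [K] of the divided differences of
    [Z x = x * S x] at these [n.+1] nodes, with the derivatives of [Z] on the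
    diagonal.

    - [K] is positive definite ([quad_form_gt0]). As [f] increases,
      [Z' (t i) >= S (t i) / 2] for [0 < i] ([monotone_wronskian_ge0]), and
      [Z' 0 = S 0 > 9 ^+ n * s / 2]: at every node the diagonal entry is at least
      half of [9 ^+ (n - i) * s]. For [i < j] the entry [K i j] is close to
      [9 ^+ (n - j) * s], because [t i] is much smaller than [t j]. The
      matrix with entries [9 ^- (maxn i j)] and halved diagonal is positive
      definite by a telescoping sum of squares, and the errors are small enough
      to be absorbed in the squares ([quad_form_bound]).

    - [K] is singular. Multiplied by [C(t i) * C(t j)] its entries become the
      values of a polynomial of degree less than [n] in each variable
      ([bezoutian]), and [n.+1] evaluations of such polynomials are linearly
      dependent ([vandermonde_relation]).

    This contradiction is [slope_bound]. *)

Set Implicit Arguments.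
Unset Strict Implicit.
Unset Printing Implicit Defensive.

Import Order.TTheory GRing.Theory Num.Theory.
Import numFieldNormedType.Exports.

Local Open Scope classical_set_scope.
Local Open Scope ring_scope.

(** * A positive definite family of matrices *)

(** The data of a geometric discretisation: values [S i] dividing by 9 at each
    step, taken at nodes [t i] that grow at least 81-fold. The factor 81 is the
    square of 9 because [Num.sqrt (t i) * S i] will be nondecreasing. *)
Record nine_scales (R : realFieldType) (n : nat) (S t : nat -> R) : Prop :=
  NineScales {
    scale_gt0 : forall i, (i <= n)%N -> 0 < S i;
    scaleS : forall i, (i < n)%N -> S i = 9 * S i.+1;
    node0 : t 0%N = 0;
    node_gt0 : forall i, (0 < i <= n)%N -> 0 < t i;
    nodeS : forall i, (i < n)%N -> 81 * t i <= t i.+1 }.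

(** For [i < j], the divided difference of the values [t i * S i] at the nodes
    is [S j - defect S t i j]; the defect vanishes when the nodes are infinitely
    far apart. *)
Definition defect (R : realFieldType) (S t : nat -> R) (i j : nat) : R :=
  (S i - S j) * t i / (t j - t i).

Lemma node_ge0 (R : realFieldType) (n : nat) (S t : nat -> R)
    (sc : nine_scales n S t) (i : nat) :
  (i <= n)%N -> 0 <= t i.
Proof.
by case: i => [|i] ilen; [rewrite (node0 sc) | exact/ltW/(node_gt0 sc)].
Qed.

Lemma node_sep (R : realFieldType) (n : nat) (S t : nat -> R)
    (sc : nine_scales n S t) (i j : nat) :
  (i < j <= n)%N -> 81 * t i <= t j.
Proof.
elim: j => // j IH /andP[]; rewrite ltnS leq_eqVlt => /predU1P[->|ij] jn.
  exact: nodeS sc _ _.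
have := IH; rewrite ij (ltnW jn) => /(_ isT) h.
have := nodeS sc jn; have := node_ge0 sc (ltnW jn); lra.
Qed.

Lemma scale_sep (R : realFieldType) (n : nat) (S t : nat -> R)
    (sc : nine_scales n S t) (i j : nat) :
  (i < j <= n)%N -> 9 * S j <= S i.
Proof.
elim: j => // j IH /andP[]; rewrite ltnS leq_eqVlt => /predU1P[->|ij] jn.
  by rewrite (scaleS sc jn).
have := IH; rewrite ij (ltnW jn) => /(_ isT) h.
have := scaleS sc jn; have := scale_gt0 sc jn; lra.
Qed.

Lemma node_lt (R : realFieldType) (n : nat) (S t : nat -> R)
    (sc : nine_scales n S t) (i j : nat) :
  (i < j <= n)%N -> t i < t j.
Proof.
move=> ijn; have := node_sep sc ijn; case/andP: ijn => ij jn.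
have := node_ge0 sc (ltnW (leq_trans ij jn)).
have : 0 < t j by apply: (node_gt0 sc); rewrite jn (leq_trans _ ij).
lra.
Qed.

Lemma defect_ge0 (R : realFieldType) (n : nat) (S t : nat -> R)
    (sc : nine_scales n S t) (i j : nat) :
  (i < j <= n)%N -> 0 <= defect S t i j.
Proof.
move=> ijn; have Sij := scale_sep sc ijn; have tij := node_lt sc ijn.
case/andP: ijn => ij jn; have Sj := scale_gt0 sc jn.
have ti := node_ge0 sc (ltnW (leq_trans ij jn)).
by rewrite /defect divr_ge0 ?mulr_ge0//; lra.
Qed.

Lemma defect_adjacent (R : realFieldType) (n : nat) (S t : nat -> R)
    (sc : nine_scales n S t) (m : nat) :
  (m < n)%N -> defect S t m m.+1 <= S m.+1 / 10.
Proof.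
move=> mn; have mmn : (m < m.+1 <= n)%N by rewrite leqnn.
have tt := node_lt sc mmn; have sep := node_sep sc mmn.
have S1 := scale_gt0 sc mn; have t0 := node_ge0 sc (ltnW mn).
rewrite /defect ler_pdivrMr ?subr_gt0// (scaleS sc mn).
have : 0 <= S m.+1 * (t m.+1 - 81 * t m) by rewrite mulr_ge0 ?subr_ge0// ltW.
lra.
Qed.

Lemma defect_decay_right (R : realFieldType) (n : nat) (S t : nat -> R)
    (sc : nine_scales n S t) (i m : nat) :
  (i < m < n)%N -> 6 * defect S t i m.+1 <= defect S t i m.
Proof.
move=> /andP[im mn].
have tim : t i < t m by apply: (node_lt sc); rewrite im ltnW.
have tmm : 81 * t m <= t m.+1 by apply: (node_sep sc); rewrite leqnn.
have Sim : 9 * S m <= S i by apply: (scale_sep sc); rewrite im ltnW.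
have Sm := scale_gt0 sc (ltnW mn); have Sm1 := scale_gt0 sc mn.
have ti : 0 <= t i by apply: (node_ge0 sc); rewrite ltnW// (ltn_trans im).
rewrite /defect mulrA ler_pdivrMr; last by lra.
rewrite [leRHS]mulrAC ler_pdivlMr; last by lra.
have e1 : 0 <= t i * ((S i - 9 * S m) * (t m.+1 - 81 * t m)).
  by rewrite !mulr_ge0 ?subr_ge0.
have e2 : 0 <= t i * ((S i - 9 * S m) * (t m - t i)).
  by rewrite !mulr_ge0 ?subr_ge0// ltW.
have e3 : 0 <= t i * (S m * (t m - t i)).
  by rewrite !mulr_ge0 ?subr_ge0// ltW.
have e4 : 0 <= t i * (S m.+1 * (t m - t i)).
  by rewrite !mulr_ge0 ?subr_ge0// ltW.
have e5 : 0 <= t i * (S m * (t m.+1 - 81 * t m)).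
  by rewrite !mulr_ge0 ?subr_ge0// ltW.
have e6 : 0 <= t i * ((S i - 9 * S m) * t i).
  by rewrite !mulr_ge0 ?subr_ge0.
have e7 : 0 <= t i * (S m * t i) by rewrite !mulr_ge0// ltW.
lra.
Qed.

Lemma defect_decay_left (R : realFieldType) (n : nat) (S t : nat -> R)
    (sc : nine_scales n S t) (i j : nat) :
  (i.+1 < j <= n)%N -> 2 * defect S t i j <= 3 * defect S t i.+1 j.
Proof.
move=> /andP[ij jn].
have iltn : (i < n)%N by apply: ltn_trans (leq_trans ij jn).
have tij : t i.+1 < t j by apply: (node_lt sc); rewrite ij.
have tii : 81 * t i <= t i.+1 by apply: (node_sep sc); rewrite leqnn.
have Sij : 9 * S j <= S i.+1 by apply: (scale_sep sc); rewrite ij.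
have Si := scaleS sc iltn.
have Sj := scale_gt0 sc jn.
have ti : 0 <= t i by apply: (node_ge0 sc); rewrite ltnW.
rewrite /defect !mulrA ler_pdivrMr; last by lra.
rewrite [leRHS]mulrAC ler_pdivlMr; last by lra.
rewrite Si.
have e1 : (2 * (9 * S i.+1 - S j) * t i) <= 3 * (S i.+1 - S j) * t i.+1.
  have : 0 <= (S i.+1 - 9 * S j) * (t i.+1 - 81 * t i).
    by rewrite mulr_ge0 ?subr_ge0.
  have : 0 <= S j * (t i.+1 - 81 * t i) by rewrite mulr_ge0 ?subr_ge0// ltW.
  have : 0 <= (S i.+1 - 9 * S j) * t i by rewrite mulr_ge0 ?subr_ge0.
  have : 0 <= S j * t i by rewrite mulr_ge0// ltW.
  lra.
by apply: ler_pM => //; rewrite ?mulr_ge0//; lra.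
Qed.

Lemma sum_dominated_by_last (R : realFieldType) (a : nat -> R) (m : nat) :
  0 <= a 0%N -> (forall i, (i < m)%N -> 2 * a i <= a i.+1) ->
  \sum_(i < m) a i <= a m.
Proof.
move=> a0; elim: m => [|m IH] h; first by rewrite big_ord0.
rewrite big_ord_recr /=; have := h m (ltnSn m).
have : \sum_(i < m) a i <= a m by apply: IH => i im; apply/h/(ltn_trans im).
lra.
Qed.

(** The part of the quadratic form kept in reserve to pay for the interaction
    of the nodes before [j] with the nodes after [j]. *)
Definition reserve (R : realFieldType) (S t c : nat -> R) (j : nat) : R :=
  \sum_(i < j) defect S t i j * 3 ^+ (j - i) * c i ^+ 2.

(** The term of the adjacent pair is
    [2 * c m.+1 * c m = (c m.+1 + 3 * c m) ^+ 2 / 3 - 3 * c m ^+ 2 - c m.+1 ^+ 2 / 3]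
    times its defect; the last two squares are what remains to pay for the
    reserve of that pair and for the pairs [(i, m.+1)] with [i < m]. The latter
    are split by [2 * a * b <= w * a ^+ 2 + b ^+ 2 / w] with [w = 3 ^+ (m.+1 - i)].
    As a defect decreases 6-fold when the right node moves away while [w] is only
    tripled, the old reserve pays twice for the squares of the [c i]: once here
    and once in the new reserve. The squares of [c m.+1] form a geometric sum. *)
Lemma defect_cost (R : realFieldType) (n : nat) (S t c : nat -> R)
    (sc : nine_scales n S t) (m : nat) : (m < n)%N ->
  2 * c m.+1 * (\sum_(i < m.+1) defect S t i m.+1 * c i) + reserve S t c m.+1 <=
  reserve S t c m + defect S t m m.+1 / 3 * (c m.+1 + 3 * c m) ^+ 2.
Proof.
move=> mn; rewrite /reserve !big_ord_recr /= subSnn expr1.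
set N := defect S t; set X := \sum_(i < m) N i m.+1 * 3 ^+ (m.+1 - i) * _.
have Nge0 i : (i < m)%N -> 0 <= N i m.+1.
  by move=> im; apply: (defect_ge0 sc); rewrite ltnS (ltnW im).
have old : 2 * X <= \sum_(i < m) N i m * 3 ^+ (m - i) * c i ^+ 2.
  rewrite mulr_sumr; apply: ler_sum => i _.
  rewrite subSn 1?ltnW// exprS.
  have := defect_decay_right sc (i := i) (m := m); rewrite ltn_ord mn => /(_ isT).
  have : 0 <= 3 ^+ (m - i) * c i ^+ 2 by rewrite mulr_ge0 ?sqr_ge0 ?exprn_ge0 ?ler0n.
  rewrite -/N; set y := 3 ^+ _ * c i ^+ 2 => y0 h.
  have : 0 <= (N i m - 6 * N i m.+1) * y by rewrite mulr_ge0// subr_ge0.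
  rewrite /y; lra.
have geo : \sum_(i < m) N i m.+1 * 3 ^- (m.+1 - i) <= N m m.+1 / 3.
  have -> : N m m.+1 / 3 = N m m.+1 * 3 ^- (m.+1 - m) by rewrite subSnn expr1.
  apply: (sum_dominated_by_last (a := fun i => N i m.+1 * 3 ^- (m.+1 - i))).
    by rewrite mulr_ge0 ?invr_ge0 ?exprn_ge0 ?ler0n ?(defect_ge0 sc).
  move=> i im; have := defect_decay_left sc (i := i) (j := m.+1).
  rewrite ltnS im mn => /(_ isT) h.
  rewrite subSS subSn 1?ltnW// exprS invfM.
  have : 0 <= 3 ^- (m - i) :> R by rewrite invr_ge0 exprn_ge0 ?ler0n.
  rewrite -/N in h *; set y := 3 ^- _ => y0.
  have : 0 <= (3 * N i.+1 m.+1 - 2 * N i m.+1) * y by rewrite mulr_ge0// subr_ge0.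
  lra.
have far : 2 * c m.+1 * (\sum_(i < m) N i m.+1 * c i) <=
    X + N m m.+1 / 3 * c m.+1 ^+ 2.
  apply: (@le_trans _ _ (X + c m.+1 ^+ 2 * (\sum_(i < m) N i m.+1 * 3 ^- (m.+1 - i)))).
    rewrite !mulr_sumr -big_split /=; apply: ler_sum => i _.
    have y0 : 0 < 3 ^+ (m.+1 - i) :> R by rewrite exprn_gt0 ?ltr0n.
    set y := 3 ^+ _ in y0 *; rewrite -subr_ge0.
    have -> : N i m.+1 * y * c i ^+ 2 + c m.+1 ^+ 2 * (N i m.+1 * y^-1) -
        2 * c m.+1 * (N i m.+1 * c i) = N i m.+1 * y^-1 * (y * c i - c m.+1) ^+ 2.
      by field; rewrite gt_eqF.
    by rewrite mulr_ge0 ?sqr_ge0 // mulr_ge0 ?(Nge0 _ (ltn_ord i)) ?invr_ge0 ?(ltW y0).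
  rewrite lerD2l mulrC; apply: ler_wpM2r geo; exact: sqr_ge0.
rewrite -/X in far *; move: far old.
set F := \sum_(i < m) N i m.+1 * c i; set V := \sum_(i < m) N i m * _ * _.
lra.
Qed.

(** The quadratic form of the symmetric matrix [K] on the indices [0..m], built
    by adding one index at a time. *)
Definition quad_form (R : realFieldType) (K : nat -> nat -> R) (c : nat -> R)
    (m : nat) : R :=
  \sum_(j < m.+1) (K j j * c j ^+ 2 + 2 * c j * (\sum_(i < j) K i j * c i)).

Lemma quad_formS (R : realFieldType) (K : nat -> nat -> R) (c : nat -> R)
    (m : nat) :
  quad_form K c m.+1 = quad_form K c m +
    (K m.+1 m.+1 * c m.+1 ^+ 2 + 2 * c m.+1 * (\sum_(i < m.+1) K i m.+1 * c i)).
Proof. by rewrite /quad_form [LHS]big_ord_recr. Qed.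

(** With all defects zero and all diagonal entries equal to [S i / 2], adding
    the index [j = m.+1] changes the form by
    [S j / 2 * c j ^+ 2 + 2 * S j * c j * s
      = S j / 3 * (s + c j) ^+ 2 - S m / 3 * s ^+ 2
        + S j / 6 * (c j + 4 * s) ^+ 2],
    where [s] is the sum of the [c i] for [i <= m]; the identity holds precisely
    because [S m = 9 * S j]. Hence the first term of the lower bound telescopes.
    Writing [u m] for [4 * s - 3 * c m], so that [u j = c j + 4 * s], the defects
    cost a multiple of [(u j - u m) ^+ 2], which is covered by the square in
    [u j] gained at this step and the part of the square in [u m] kept from the
    previous one. The left disjunct is needed because the inequality is strict. *)
Lemma quad_form_bound (R : realFieldType) (n : nat) (S t c : nat -> R)
    (K : nat -> nat -> R) (sc : nine_scales n S t)
    (diag : forall i, (i <= n)%N -> S i / 2 <= K i i)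
    (offdiag : forall i j, (i < j <= n)%N -> K i j = S j - defect S t i j)
    (m : nat) : (m <= n)%N ->
  (forall i, (i <= m)%N -> c i = 0) \/
  let s := \sum_(i < m.+1) c i in
  S m / 3 * s ^+ 2 + reserve S t c m + S m / 24 * (4 * s - 3 * c m) ^+ 2 <
  quad_form K c m.
Proof.
have fresh j : (j <= n)%N -> c j != 0 ->
    S j / 3 * c j ^+ 2 + S j / 24 * (4 * c j - 3 * c j) ^+ 2 < K j j * c j ^+ 2.
  move=> jn cj0; have : 0 < c j ^+ 2 by rewrite exprn_even_gt0.
  have Sj := scale_gt0 sc jn; have := diag j jn; set y := c j ^+ 2 => h y0.
  have -> : (4 * c j - 3 * c j) ^+ 2 = y by rewrite /y; ring.
  have : 0 <= (K j j - S j / 2) * y by rewrite mulr_ge0 ?subr_ge0// ltW.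
  have : 0 < S j * y by rewrite mulr_gt0.
  lra.
elim: m => [|m IH] mn.
  have [c0|c0] := eqVneq (c 0%N) 0; first by left => i; rewrite leqn0 => /eqP->.
  right; rewrite /quad_form /reserve !big_ord1 !big_ord0 mulr0 !addr0.
  exact: fresh.
have [c0|] := IH (ltnW mn).
  have z0 (F : nat -> R) : \sum_(i < m.+1) F i * c i = 0.
    by rewrite big1// => i _; rewrite c0 ?mulr0// -ltnS.
  have s0 : \sum_(i < m.+1) c i = 0 by rewrite big1// => i _; rewrite c0// -ltnS.
  have [cm0|cm0] := eqVneq (c m.+1) 0.
    by left => i; rewrite leq_eqVlt => /predU1P[->//|]; rewrite ltnS => /c0.
  right; rewrite quad_formS big_ord_recr /= s0 add0r (z0 (K ^~ m.+1)) mulr0 addr0.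
  have -> : reserve S t c m.+1 = 0.
    by rewrite /reserve big1// => i _; rewrite c0 ?expr0n ?mulr0// -ltnS.
  have -> : quad_form K c m = 0.
    rewrite /quad_form big1// => i _; have ci0 : c i = 0 by rewrite c0 -1?ltnS.
    rewrite ci0 expr0n mulr0 add0r.
    by rewrite mulr0 mul0r.
  by rewrite addr0 add0r; apply: fresh.
rewrite /= => Qm; right; rewrite quad_formS.
have -> : \sum_(i < m.+1) K i m.+1 * c i =
    S m.+1 * (\sum_(i < m.+1) c i) - \sum_(i < m.+1) defect S t i m.+1 * c i.
  rewrite mulr_sumr -sumrB; apply: eq_bigr => i _.
  by rewrite offdiag ?mulrBl// ltn_ord.
have cost := defect_cost c sc mn; have adj := defect_adjacent sc mn.
rewrite (big_ord_recr m.+1) /=; rewrite (scaleS sc mn) in Qm.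
have dia := diag _ mn; have S0 := scale_gt0 sc mn.
set s := \sum_(i < m.+1) c i in Qm *; set D := \sum_(i < m.+1) _ in cost *.
set x := c m.+1 in cost *; set Q := quad_form K c m in Qm *.
set d := defect S t m m.+1 in adj cost.
have : 0 <= (K m.+1 m.+1 - S m.+1 / 2) * x ^+ 2.
  by rewrite mulr_ge0 ?sqr_ge0// subr_ge0.
have : 0 <= (S m.+1 / 10 - d) * (x + 3 * c m) ^+ 2.
  by rewrite mulr_ge0 ?sqr_ge0// subr_ge0.
set u := x + 4 * s; set v := 4 * s - 3 * c m.
have : 0 <= S m.+1 * u ^+ 2 by rewrite mulr_ge0 ?sqr_ge0// ltW.
have : 0 <= S m.+1 * v ^+ 2 by rewrite mulr_ge0 ?sqr_ge0// ltW.
have : 0 <= S m.+1 * (u + v) ^+ 2 by rewrite mulr_ge0 ?sqr_ge0// ltW.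
rewrite /u /v; lra.
Qed.

Lemma quad_form_gt0 (R : realFieldType) (n : nat) (S t c : nat -> R)
    (K : nat -> nat -> R) (sc : nine_scales n S t)
    (diag : forall i, (i <= n)%N -> S i / 2 <= K i i)
    (offdiag : forall i j, (i < j <= n)%N -> K i j = S j - defect S t i j)
    (k : nat) : (k <= n)%N -> c k != 0 -> 0 < quad_form K c n.
Proof.
move=> kn ck0; have [c0|/=] := quad_form_bound c sc diag offdiag (leqnn n).
  by rewrite c0// eqxx in ck0.
apply: le_lt_trans; have Sn := scale_gt0 sc (leqnn n).
have sq (r x : R) : 0 < r -> 0 <= S n / r * x ^+ 2.
  by move=> r0; rewrite mulr_ge0 ?sqr_ge0// divr_ge0 ?ltW.
rewrite !addr_ge0 ?sq ?ltr0n//; apply: sumr_ge0 => i _.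
rewrite mulr_ge0 ?sqr_ge0// mulr_ge0 ?exprn_ge0 ?ler0n//.
by rewrite (defect_ge0 sc) ?ltn_ord ?leqnn.
Qed.

Lemma sum_sym_quad_form (R : realFieldType) (K : nat -> nat -> R)
    (c : nat -> R) (m : nat)
    (sym : forall i j, (i < j <= m)%N -> K j i = K i j) :
  \sum_(i < m.+1) \sum_(j < m.+1) c i * c j * K i j = quad_form K c m.
Proof.
elim: m sym => [|m IH] sym.
  by rewrite /quad_form !big_ord1 big_ord0 mulr0 addr0 mulrC.
rewrite quad_formS -IH; last first.
  by move=> i j /andP[ij jm]; apply: sym; rewrite ij ltnW.
rewrite big_ord_recr /=.
under eq_bigr do rewrite big_ord_recr /=.
rewrite big_split /= -addrA; congr (_ + _).
rewrite [X in _ + X](big_ord_recr m.+1) /=.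
have -> : \sum_(i < m.+1) c m.+1 * c i * K m.+1 i =
    \sum_(i < m.+1) c i * c m.+1 * K i m.+1.
  by apply: eq_bigr => i _; rewrite sym ?ltn_ord ?leqnn// (mulrC (c i)).
have -> : \sum_(i < m.+1) c i * c m.+1 * K i m.+1 =
    c m.+1 * \sum_(i < m.+1) K i m.+1 * c i.
  by rewrite mulr_sumr; apply: eq_bigr => i _; ring.
ring.
Qed.

(** * The Bezoutian of a rational function of degree n *)

(** The evaluations at [n.+1] points are linearly dependent on the space of
    polynomials of degree less than [n], which has dimension [n]. *)
Lemma vandermonde_relation (R : fieldType) (n : nat) (t : nat -> R) :
  exists d : nat -> R, (exists2 k, (k <= n)%N & d k != 0) /\
    forall P : {poly R}, (size P <= n)%N -> \sum_(i < n.+1) d i * P.[t i] = 0.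
Proof.
pose V := \matrix_(i < n.+1, j < n) t i ^+ j.
have : kermx V != 0.
  rewrite -mxrank_eq0 mxrank_ker subn_eq0 -ltnNge ltnS.
  exact: leq_trans (rank_leq_col V) _.
case/rowV0Pn => v /sub_kermxP vV; rewrite -subr_eq0 subr0 => v0.
exists (fun i => v 0 (inord i)); split.
  have [k vk] : exists k, v 0 k != 0.
    apply/existsP; rewrite -negb_forall; apply: contra v0 => /forallP vz.
    by apply/eqP/rowP => k; rewrite mxE; apply/eqP/vz.
  by exists k; [rewrite -ltnS ltn_ord | rewrite inord_val].
move=> P sP; under eq_bigr => i _.
  rewrite inord_val (horner_coef_wide _ sP) mulr_sumr; over.
rewrite exchange_big big1 //= => j _.
have := congr1 (fun M : 'rV_n => M 0 j) vV; rewrite !mxE => e.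
transitivity (P`_j * \sum_(i < n.+1) v 0 i * V i j); last by rewrite e mulr0.
by rewrite mulr_sumr; apply: eq_bigr => i _; rewrite mxE mulrCA.
Qed.

(** The divided difference of [x * A / C] with the denominators cleared is a
    polynomial of degree less than [n] in each variable. *)
Lemma bezoutian (R : fieldType) (n : nat) (A C : {poly R}) (y : R) :
  (size A <= n)%N -> (size C <= n.+1)%N ->
  exists B : {poly R}, [/\ (size B <= n)%N,
    forall x, x * A.[x] * C.[y] - y * A.[y] * C.[x] = B.[x] * (x - y) &
    B.[y] = A.[y] * C.[y] + y * (A^`().[y] * C.[y] - A.[y] * C^`().[y])].
Proof.
move=> sA sC; pose P := C.[y] *: ('X * A) - (y * A.[y]) *: C.
have PE x : P.[x] = x * A.[x] * C.[y] - y * A.[y] * C.[x].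
  by rewrite /P hornerD hornerN !hornerZ hornerM hornerX; ring.
have : root P y by rewrite /root PE; apply/eqP; ring.
case/factor_theorem => B PB; exists B; split.
- have sP : (size P <= n.+1)%N.
    rewrite (leq_trans (size_polyD _ _))// geq_max size_polyN.
    rewrite !(leq_trans (size_scale_leq _ _))//.
    by rewrite (leq_trans (size_polyMleq _ _))// size_polyX.
  have [->|B0] := eqVneq B 0; first by rewrite size_poly0.
  by move: sP; rewrite PB size_Mmonic ?monicXsubC// size_XsubC addnC.
- by move=> x; rewrite -PE PB hornerM hornerXsubC.
have : P^`().[y] = B.[y].
  by rewrite PB derivM derivXsubC hornerD !hornerM hornerXsubC subrr mulr0 add0r hornerC mulr1.
move<-; rewrite /P derivB !derivZ derivM derivX.
by rewrite hornerD hornerN !hornerZ hornerD !hornerM hornerX hornerC; ring.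
Qed.

(** * Monotone odd rational functions in reduced form *)

Lemma deriv_ge0_of_left_le0 (R : realType) (P : {poly R}) (x : R) :
  0 < x -> P.[x] = 0 -> (forall y, 0 <= y < x -> P.[y] <= 0) ->
  0 <= P^`().[x].
Proof.
move=> x0 Px Pneg.
have /factor_theorem[Q PQ] : root P x by apply/rootP.
have -> : P^`().[x] = Q.[x].
  rewrite PQ derivM derivXsubC hornerD !hornerM hornerXsubC subrr mulr0 add0r.
  by rewrite hornerC mulr1.
rewrite leNgt; apply/negP => Qx.
have /nbhs_ballP[e /= e0 Qe] : \forall y \near x, Q.[y] < 0.
  exact: (cvgr_lt _ (@continuous_horner _ Q x) _ Qx).
pose h := Num.min (e / 2) x.
have h0 : 0 < h by rewrite lt_min x0 divr_gt0.
have hx : h <= x by rewrite ge_min lexx orbT.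
have he : h < e by rewrite gt_min ltr_pdivrMr// ltr_pMr// ltr1n.
have Qy : Q.[x - h] < 0.
  by apply: Qe; rewrite /ball /= opprB addrC subrK gtr0_norm.
have : P.[x - h] <= 0 by apply: Pneg; lra.
rewrite PQ hornerM hornerXsubC addrAC subrr add0r mulrN oppr_le0 leNgt.
by rewrite pmulr_llt0// Qy.
Qed.

(** [x * A(x^2) / C(x^2)] is nondecreasing on the unit interval; the
    denominators are cleared so that the condition is polynomial. *)
Definition odd_quotient_nondecreasing (R : realType) (A C : {poly R}) : Prop :=
  forall x y : R, 0 <= x -> x <= y -> y <= 1 ->
    x * A.[x ^+ 2] * C.[y ^+ 2] <= y * A.[y ^+ 2] * C.[x ^+ 2].

(** Up to a positive factor this is the derivative of [x * A(x^2) / C(x^2)] at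
    [x = Num.sqrt s]. At [s = 1] monotonicity gives information on the left of
    [x] only. *)
Lemma monotone_wronskian_ge0 (R : realType) (A C : {poly R}) (s : R) :
  odd_quotient_nondecreasing A C -> 0 < s <= 1 ->
  0 <= A.[s] * C.[s] + 2 * s * (A^`().[s] * C.[s] - A.[s] * C^`().[s]).
Proof.
move=> mono /andP[s0 s1]; pose x := Num.sqrt s.
have x0 : 0 < x by rewrite sqrtr_gt0.
have x1 : x <= 1 by rewrite -sqrtr1 ler_sqrt.
have xs : x ^+ 2 = s by rewrite sqr_sqrtr// ltW.
pose P := C.[s] *: ('X * (A \Po 'X^2)) - (x * A.[s]) *: (C \Po 'X^2).
have PE y : P.[y] = y * A.[y ^+ 2] * C.[x ^+ 2] - x * A.[x ^+ 2] * C.[y ^+ 2].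
  rewrite xs /P hornerD hornerN !hornerZ hornerM hornerX !horner_comp hornerXn.
  by ring.
have : 0 <= P^`().[x].
  apply: deriv_ge0_of_left_le0 => // [|y /andP[y0 yx]]; rewrite PE ?subrr//.
  by rewrite subr_le0; apply: mono => //; apply: ltW.
rewrite /P derivB !derivZ derivM derivX !deriv_comp derivXn expr1.
rewrite hornerD hornerN !hornerZ hornerD !hornerM hornerX hornerC.
rewrite !horner_comp hornerXn hornerMn hornerX xs -mulr_natr.
by rewrite -!xs; lra.
Qed.

(** Since [9 * A.[y] / C.[y]] lies between the values of [A / C] at [0] and at
    [y], it is taken at some [z] in between, and monotonicity separates [z] from
    [y]. *)
Lemma next_node (R : realType) (A C : {poly R}) (y s : R)
    (C_gt0 : forall s : R, 0 <= s <= 1 -> 0 < C.[s])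
    (mono : odd_quotient_nondecreasing A C) :
  0 < y <= 1 -> 0 < s -> A.[y] = s * C.[y] -> 9 * s * C.[0] < A.[0] ->
  exists z, [/\ 0 < z, 81 * z <= y & A.[z] = 9 * s * C.[z]].
Proof.
move=> /andP[y0 y1] s0 Ay A0.
have Cy : 0 < C.[y] by apply: C_gt0; rewrite y1 ltW.
pose P := (9 * s) *: C - A.
have PE x : P.[x] = 9 * s * C.[x] - A.[x].
  by rewrite /P hornerD hornerN hornerZ.
have [||z /andP[z0 zy] /rootP] := @poly_ivt _ P 0 y; first exact: ltW.
  rewrite !PE Ay subr_le0 (ltW A0) -mulrBl mulr_ge0 ?ltW//=.
  by rewrite subr_gt0 ltr_pMl// ltr1n.
rewrite PE => /eqP; rewrite subr_eq0 => /eqP Az.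
have z_gt0 : 0 < z.
  rewrite lt_neqAle z0 andbT; apply: contraTneq A0 => z0'.
  by rewrite z0' Az ltxx.
have Cz : 0 < C.[z] by apply: C_gt0; rewrite z0 (le_trans zy).
exists z; split => //.
have szy : Num.sqrt z <= Num.sqrt y by rewrite ler_sqrt// ltW.
have sy1 : Num.sqrt y <= 1 by rewrite -sqrtr1 ler_sqrt.
have := mono _ _ (sqrtr_ge0 z) szy sy1.
rewrite !sqr_sqrtr ?(ltW y0)// -Az Ay => h.
have : 9 * Num.sqrt z <= Num.sqrt y.
  rewrite -(ler_pM2r (mulr_gt0 s0 (mulr_gt0 Cz Cy))); move: h; lra.
rewrite -(@ler_pXn2r _ 2)// ?nnegrE ?mulr_ge0 ?sqrtr_ge0//.
by rewrite exprMn !sqr_sqrtr ?(ltW y0)// -natrX.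
Qed.

Lemma geometric_nodes (R : realType) (A C : {poly R})
    (C_gt0 : forall s : R, 0 <= s <= 1 -> 0 < C.[s])
    (mono : odd_quotient_nondecreasing A C) (m : nat) (y s : R) :
  0 < y <= 1 -> 0 < s -> A.[y] = s * C.[y] -> 9 ^+ m * s * C.[0] < A.[0] ->
  exists t : nat -> R, [/\ t m = y,
    forall i, (i <= m)%N -> 0 < t i <= y /\ A.[t i] = 9 ^+ (m - i) * s * C.[t i] &
    forall i, (i < m)%N -> 81 * t i <= t i.+1].
Proof.
elim: m y s => [|m IH] y s /andP[y0 y1] s0 Ay A0.
  exists (fun=> y); split => // i; rewrite leqn0 => /eqP->.
  by rewrite y0 lexx subnn mul1r.
have C0 : 0 < C.[0] by apply: C_gt0; rewrite lexx ler01.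
have sC0 : 0 < s * C.[0] by rewrite mulr_gt0.
have [||||z [z0 zy Az]] := @next_node _ A C y s C_gt0 mono => //.
- by rewrite y0.
- apply: le_lt_trans A0; rewrite -!mulrA ler_pM2r// exprS ler_peMr//.
  by rewrite exprn_ege1 ?ler1n.
have [||||t [tm tA tS]] := IH z (9 * s).
- by rewrite z0/=; lra.
- by rewrite mulr_gt0.
- exact: Az.
- by rewrite mulrA -exprSr.
exists (fun i => if (i <= m)%N then t i else y); split; first by rewrite ltnn.
- move=> i im; case: leqP => [|mi]; last first.
    have -> : i = m.+1 by apply/eqP; rewrite eqn_leq im.
    by rewrite y0 lexx subnn mul1r.
  move=> {}im; have [/andP[ti0 tiz] ->] := tA i im; split.
    by rewrite ti0/=; lra.
  by rewrite subSn// exprSr -!mulrA.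
move=> i; rewrite ltnS => im; rewrite im; case: ltnP => [|mi]; first exact: tS.
by have -> : i = m; [apply/eqP; rewrite eqn_leq im | rewrite tm].
Qed.

(** If the bound failed, the matrix of divided differences of [x * A / C] at
    [0] and at the nodes where [A / C] equals [9 ^+ (n - i)] times its value at
    [1] would be positive definite; but it has size [n.+1] and rank at most
    [n]. *)
Theorem slope_bound (R : realType) (n : nat) (A C : {poly R})
    (n_gt0 : (0 < n)%N) (sA : (size A <= n)%N) (sC : (size C <= n.+1)%N)
    (C_gt0 : forall s : R, 0 <= s <= 1 -> 0 < C.[s])
    (mono : odd_quotient_nondecreasing A C) (A1 : 0 < A.[1]) :
  A.[0] / C.[0] <= 2^-1 * 9 ^+ n * (A.[1] / C.[1]).
Proof.
rewrite leNgt; apply/negP => big.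
have C0 : 0 < C.[0] by apply: C_gt0; rewrite lexx ler01.
have C1 : 0 < C.[1] by apply: C_gt0; rewrite lexx ler01.
pose s := A.[1] / C.[1]; have s0 : 0 < s by rewrite divr_gt0.
case: n n_gt0 sA sC big => // m _ sA sC big; set n := m.+1.
have [||||tt [ttm ttA ttS]] := @geometric_nodes _ A C C_gt0 mono m 1 s.
- by rewrite ltr01 lexx.
- exact: s0.
- by rewrite divfK// gt_eqF.
- rewrite -ltr_pdivlMr//; apply: le_lt_trans big; rewrite -/s ler_pM2r// exprS.
  by have : 0 <= 9 ^+ m :> R; [rewrite exprn_ge0 | lra].
(* At the index 0, [S 0 = 9 ^+ n * s] is not the value of [A / C] at [t 0 = 0]:
   the assumption to be refuted is that this value exceeds [S 0 / 2], which is
   all that the diagonal entry at 0 has to satisfy. *)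
pose t i := if i is i'.+1 then tt i' else 0.
pose S i : R := 9 ^+ (n - i) * s.
have sc : nine_scales n S t.
  split => //.
  - by move=> i _; rewrite mulr_gt0 ?exprn_gt0.
  - by move=> i im; rewrite /S [RHS]mulrA -exprS subnS prednK ?subn_gt0.
  - by case=> // i im; have [/andP[]] := ttA i im.
  - by case=> [|i] im; [rewrite mulr0; have [/andP[/ltW]] := ttA 0%N isT | exact: ttS].
have t01 i : (i <= n)%N -> 0 <= t i <= 1.
  case: i => [|i im]; first by rewrite lexx ler01.
  by have [/andP[/ltW-> ->]] := ttA i im.
have Ct i : (i <= n)%N -> 0 < C.[t i] by move=> /t01/C_gt0.
have At i : (0 < i <= n)%N -> A.[t i] = S i * C.[t i].
  by case: i => // i /= im; have [_ ->] := ttA i im.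
have tA i : (i <= n)%N -> t i * A.[t i] = t i * S i * C.[t i].
  by case: i => [|i] im; [rewrite !mul0r | rewrite At// mulrA].
have /choice[B BP] := fun j : nat => bezoutian (t j) sA sC.
have [d [[k kn dk] dP]] := vandermonde_relation n t.
(* The factor [C.[t i]] clears the denominators of [K i j]. *)
pose c i := d i * C.[t i].
pose K i j := (B j).[t i] / (C.[t i] * C.[t j]).
have K_diag i : (i <= n)%N -> S i / 2 <= K i i.
  move=> im; rewrite /K; have [_ _ ->] := BP i; have Ci := Ct i im.
  rewrite ler_pdivlMr ?mulr_gt0//.
  have [i0|i0] := posnP i.
    rewrite i0 (node0 sc) mul0r addr0; move: big; rewrite ltr_pdivlMr// => /ltW.
    by rewrite -(ler_pM2r C0) /S subn0 -/s -/n; lra.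
  have := monotone_wronskian_ge0 (s := t i) mono.
  rewrite (node_gt0 sc) ?i0//; have /andP[_ ->] := t01 _ im => /(_ isT).
  by rewrite At ?i0//; lra.
have K_off i j : (i < j <= n)%N -> K i j = S j - defect S t i j.
  move=> ijn; have tij := node_lt sc ijn; case/andP: ijn => ij jn.
  have Ci := Ct i (ltnW (leq_trans ij jn)); have Cj := Ct j jn.
  have [_ /(_ (t i)) e _] := BP j; move: e.
  rewrite !tA// ?(ltnW (leq_trans ij jn))// => e.
  have tn0 : t i - t j != 0 by rewrite subr_eq0 lt_eqF.
  rewrite /K; have -> : (B j).[t i] =
      (t i * S i - t j * S j) * (C.[t i] * C.[t j]) / (t i - t j).
    by apply: (mulIf tn0); rewrite divfK// -e; ring.
  rewrite /defect; field.
  by rewrite tn0 -oppr_eq0 opprB tn0 !gt_eqF.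
have K_sym i j : (i < j <= n)%N -> K j i = K i j.
  move=> ijn; have tij := node_lt sc ijn.
  have tn0 : t i - t j != 0 by rewrite subr_eq0 lt_eqF.
  have [_ /(_ (t i)) e1 _] := BP j; have [_ /(_ (t j)) e2 _] := BP i.
  have e : (B j).[t i] = (B i).[t j].
    by apply: (mulIf tn0); rewrite -e1 -[t i - t j]opprB mulrN -e2; ring.
  by rewrite /K e [C.[t j] * _]mulrC.
(* Positive by definiteness, yet zero because for fixed [j] the relation [d]
   kills the polynomial [B j]. *)
have : 0 < quad_form K c n.
  apply: (quad_form_gt0 sc K_diag K_off kn).
  by rewrite mulf_neq0// gt_eqF// Ct.
rewrite -(sum_sym_quad_form c K_sym) exchange_big big1 ?ltxx//= => j _.
transitivity (d j * \sum_(i < n.+1) d i * (B j).[t i]).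
  rewrite mulr_sumr; apply: eq_bigr => i _; rewrite /c /K.
  have Ci : 0 < C.[t i] by apply: Ct; rewrite -ltnS.
  have Cj : 0 < C.[t j] by apply: Ct; rewrite -ltnS.
  by field; rewrite !gt_eqF.
by have [sB _ _] := BP j; rewrite dP ?mulr0.
Qed.

(** * From continuous rational functions to reduced quotients *)

Lemma near_nonroot (R : realType) (q : {poly R}) (x e : R) : q != 0 ->
  x \in `[-1, 1] -> 0 < e ->
  exists y, [/\ y \in `[-1, 1], `|x - y| < e & q.[y] != 0].
Proof.
move=> q0; rewrite in_itv /= => /andP[x1 x2] e0.
pose sg : R := if x <= 0 then 1 else -1.
have sg1 : sg * sg = 1 by rewrite /sg; case: ifP => _; ring.
(* Infinitely many points [y k] on the side of [x] that faces [0]. *)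
pose r := Num.min (e / 2) 1; pose y (k : nat) := x + sg * (r / k.+1%:R).
have r0 : 0 < r by rewrite lt_min ltr01 divr_gt0.
have k0 (k : nat) : 0 < k.+1%:R :> R by rewrite ltr0n.
have yr k : 0 < r / k.+1%:R <= r.
  by rewrite divr_gt0//= ler_pdivrMr// ler_pMr// ler1n.
have r1 : r <= 1 by rewrite ge_min lexx orbT.
have re : r < e.
  by rewrite gt_min ltr_pdivrMr// ltr_pMr// ltr1n.
have y_inj : injective y.
  move=> k l /addrI/(congr1 ( *%R sg)); rewrite !mulrA sg1 !mul1r.
  move/(mulfI (lt0r_neq0 r0))/invr_inj/eqP.
  by rewrite eqr_nat eqSS => /eqP.
have : ~~ all (root q) (mkseq y (size q)).
  apply/negP => /(max_poly_roots q0); rewrite mkseq_uniq// size_mkseq ltnn.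
  by move=> /(_ isT).
case/allPn => _ /mapP[k _ ->] qk.
have /andP[yk0 ykr] := yr k; exists (y k); split => //.
  move: yk0 ykr; rewrite in_itv /= /y /sg; move: (r / _) => z z0 zr.
  by case: (leP x 0) => x0; apply/andP; split; lra.
rewrite /y opprD addrA subrr add0r normrN normrM (gtr0_norm yk0).
have -> : `|sg| = 1 by rewrite /sg; case: ifP => _; rewrite ?normrN normr1.
by rewrite mul1r (le_lt_trans ykr).
Qed.

Lemma within_continuous_eq0 (R : realType) (h : R -> R) (q : {poly R}) :
  q != 0 -> {within `[-1, 1], continuous h} ->
  {in `[-1, 1], forall x, q.[x] != 0 -> h x = 0} ->
  {in `[-1, 1], forall x, h x = 0}.
Proof.
move=> q0 hc hq x xI; apply/eqP; apply: contraT => hx.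
have hx0 : 0 < `|h x| by rewrite normr_gt0.
have /cvgrPdist_lt/(_ _ hx0) := (subspace_continuousP _ h).1 hc x xI.
rewrite /prop_near1 /within /= => /nbhs_ballP[e /= e0 He].
have [y [yI xy qy]] := near_nonroot q0 xI e0.
have := He y xy; rewrite /= yI => /(_ isT).
by rewrite (hq y yI qy) subr0 ltxx.
Qed.

(** After division by the greatest common divisor, the equation
    [f * q = p] extends by continuity to the whole interval, and a zero of [q]
    there would be a common zero. *)
Lemma rat_fun_reduced (R : realType) (m : nat) (f : R -> R) : rat_fun m f ->
  exists p q : {poly R}, [/\ (size p <= m.+1)%N, (size q <= m.+1)%N &
    {in `[-1, 1], forall x, q.[x] != 0 /\ f x * q.[x] = p.[x]}].
Proof.
case=> fc [p [q [sp sq q0 fpq]]]; pose g := gcdp p q.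
have g0 : g != 0 by rewrite gcdp_eq0 (negPf q0) andbF.
have pE : p = p %/ g * g by rewrite divpK// dvdp_gcdl.
have qE : q = q %/ g * g by rewrite divpK// dvdp_gcdr.
have cop : coprimep (p %/ g) (q %/ g) by rewrite coprimep_div_gcd// q0 orbT.
exists (p %/ g), (q %/ g); split.
- exact: leq_trans (leq_divp _ _) sp.
- exact: leq_trans (leq_divp _ _) sq.
have fq x : x \in `[-1, 1] -> f x * (q %/ g).[x] = (p %/ g).[x].
  move=> xI; apply/eqP; rewrite -subr_eq0; apply/eqP; move: x xI.
  apply: (within_continuous_eq0 q0).
    move=> x; apply: cvgB.
      apply: cvgM; first exact: fc.
      exact: (continuous_subspaceT (@continuous_horner _ (q %/ g))).
    exact: (continuous_subspaceT (@continuous_horner _ (p %/ g))).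
  move=> x xI qx; have := qx; rewrite {1}qE hornerM mulf_eq0 negb_or.
  case/andP=> q1x gx; rewrite fpq// {1}pE {1}qE !hornerM.
  by apply/eqP; rewrite subr_eq0 -mulf_div divff// mulr1 divfK.
move=> x xI; split; last exact: fq.
apply/negP => q1x; have : root (p %/ g) x.
  by rewrite /root -fq// (eqP q1x) mulr0.
by move/(coprimep_root cop); rewrite q1x.
Qed.

(** * Odd rational functions *)

Lemma poly_gt0_of_nonroot (R : rcfType) (q : {poly R}) (a b c : R) :
  a <= c <= b -> 0 < q.[c] -> (forall x : R, a <= x <= b -> q.[x] != 0) ->
  forall x : R, a <= x <= b -> 0 < q.[x].
Proof.
move=> /andP[ac cb] qc qN0 x /andP[ax xb]; rewrite ltNge; apply/negP => qx.
case: (leP x c) => xc.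
  have [|z /andP[xz zc] /rootP qz] := @poly_ivt R q x c xc.
    by rewrite qx (ltW qc).
  by have := qN0 z; rewrite qz eqxx (le_trans ax xz) (le_trans zc cb) => /(_ isT).
have [|z /andP[cz zx] /rootP] := @poly_ivt R (- q) c x (ltW xc).
  by rewrite !hornerN oppr_le0 oppr_ge0 qx (ltW qc).
rewrite hornerN => /eqP; rewrite oppr_eq0 => /eqP qz.
by have := qN0 z; rewrite qz eqxx (le_trans ac cz) (le_trans zx xb) => /(_ isT).
Qed.

Lemma horner_even_odd (R : comNzRingType) (p : {poly R}) (x : R) :
  p.[x] = (even_poly p).[x ^+ 2] + (odd_poly p).[x ^+ 2] * x.
Proof.
by rewrite -{1}(poly_even_odd p) hornerD hornerM hornerX !horner_comp hornerXn.
Qed.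

(** Subtracting the equations [f * q = p] at [x] and at [- x] keeps only the
    even part of [q] and the odd part of [p].  The even part inherits the sign
    of [q], which is constant by the intermediate value theorem. *)
Lemma odd_rat_funP (R : realType) (n : nat) (f : R -> R) : rat_fun (2 * n) f ->
  {in `[-1, 1], forall x, f (- x) = - f x} ->
  exists A C : {poly R}, [/\ (size A <= n)%N, (size C <= n.+1)%N &
    {in `[-1, 1], forall x, 0 < C.[x ^+ 2] /\ f x * C.[x ^+ 2] = x * A.[x ^+ 2]}].
Proof.
move=> /rat_fun_reduced[p [q [sp sq pq]]] f_odd.
have I0 : (0 : R) \in `[-1, 1] by rewrite in_itv /=; apply/andP; split; lra.
have [q00 _] := pq _ I0.
(* Multiplying by [q.[0]] makes the denominator positive at [0]. *)
pose p1 := q.[0] *: p; pose q1 := q.[0] *: q.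
have q1_gt0 : forall x : R, -1 <= x <= 1 -> 0 < q1.[x].
  apply: (poly_gt0_of_nonroot (c := 0)) => [||x xI].
  - by move: I0; rewrite in_itv.
  - by rewrite hornerZ -expr2 exprn_even_gt0.
  - by rewrite hornerZ mulf_neq0// (pq x _).1// in_itv.
exists (odd_poly p1), (even_poly q1); split.
- apply: leq_trans (size_odd_poly _) _.
  rewrite (leq_trans (half_leq (leq_trans (size_scale_leq _ _) sp)))//.
  by rewrite mul2n /= uphalf_double.
- apply: leq_trans (size_even_poly _) _.
  rewrite (leq_trans (uphalf_leq (leq_trans (size_scale_leq _ _) sq)))//.
  by rewrite mul2n /= doubleK.
move=> x xI.
have NxI : - x \in `[-1, 1].
  by move: xI; rewrite !in_itv /= => /andP[? ?]; apply/andP; split; lra.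
have qx : 0 < q1.[x] by apply: q1_gt0; move: xI; rewrite in_itv.
have qNx : 0 < q1.[- x] by apply: q1_gt0; move: NxI; rewrite in_itv.
have fx : f x * q1.[x] = p1.[x] by rewrite !hornerZ mulrCA (pq x xI).2.
have fNx : - f x * q1.[- x] = p1.[- x].
  by rewrite -f_odd// !hornerZ mulrCA (pq _ NxI).2.
move: qx qNx fx fNx; rewrite !(horner_even_odd _ x) !(horner_even_odd _ (- x)).
by rewrite sqrrN => *; split; lra.
Qed.

(** Near [0] the difference quotient of [f] at [0] is [A.[h ^+ 2] / C.[h ^+ 2]],
    which is continuous there. *)
Lemma derive1_odd_quotient (R : realType) (A C : {poly R}) (f : R -> R) :
  {in `[-1, 1], forall x, 0 < C.[x ^+ 2] /\ f x * C.[x ^+ 2] = x * A.[x ^+ 2]} ->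
  (f^`() 0)%classic = A.[0] / C.[0].
Proof.
move=> fAC; have I0 : (0 : R) \in `[-1, 1].
  by rewrite in_itv /=; apply/andP; split; lra.
have [C0 f0] := fAC _ I0; rewrite expr0n /= in C0 f0.
have {}f0 : f 0 = 0.
  by apply/eqP; move/eqP: f0; rewrite mul0r mulf_eq0 (gt_eqF C0) orbF.
have cvgAC : (A \Po 'X^2).[h] / (C \Po 'X^2).[h] @[h --> (0 : R)]
    --> A.[0] / C.[0].
  have E p : p.[0] = (p \Po 'X^2).[0] :> R.
    by rewrite horner_comp hornerXn expr0n.
  rewrite (E A) (E C); apply: cvgM; first exact: continuous_horner.
  by apply: cvgV; [rewrite -E gt_eqF | exact: continuous_horner].
apply: cvg_lim; first exact: norm_hausdorff.
apply: cvg_trans (cvg_trans (cvg_app _ (cvg_within _)) cvgAC).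
apply: near_eq_cvg; near=> h.
have h0 : h != 0 by near: h; exact: nbhs_dnbhs_neq.
have hI : h \in `[-1, 1].
  rewrite in_itv /= -ler_norml; near: h; exact: dnbhs0_le.
have [Ch fh] := fAC _ hI.
rewrite addr0 f0 subr0 !horner_comp hornerXn.
apply/(mulIf (lt0r_neq0 Ch)); rewrite divfK ?lt0r_neq0//.
by rewrite -scalerAl fh; exact: (esym (mulKf h0 _)).
Unshelve. all: by end_near. Qed.

Theorem theorem1 (R : realType) (n : nat) (f : R -> R)
    (n_ge1 : (1 <= n)%N)
    (f_rat : rat_fun (2 * n) f)
    (f_odd : {in `[-1, 1], forall x, f (- x) = - f x})
    (f_incr : {in `[-1, 1] &, {homo f : x y / x < y}}) :
  (f^`() 0)%classic <= 2^-1 * 9 ^+ n * f 1.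
Proof.
have [A [C [sA sC fAC]]] := odd_rat_funP f_rat f_odd.
have I01 (x : R) : 0 <= x <= 1 -> x \in `[-1, 1].
  by rewrite in_itv /= => /andP[? ?]; apply/andP; split; lra.
have C_gt0 (s : R) : 0 <= s <= 1 -> 0 < C.[s].
  move=> /andP[s0 s1]; rewrite -(sqr_sqrtr s0); apply: (fAC _ _).1.
  by apply: I01; rewrite sqrtr_ge0 -sqrtr1 ler_sqrt.
have mono : odd_quotient_nondecreasing A C.
  move=> x y x0 xy y1.
  have xI : x \in `[-1, 1] by apply: I01; rewrite x0 (le_trans xy y1).
  have yI : y \in `[-1, 1] by apply: I01; rewrite (le_trans x0 xy).
  have [Cx <-] := fAC _ xI; have [Cy <-] := fAC _ yI.
  rewrite mulrAC ler_pM2r// ler_pM2r//.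
  move: xy; rewrite le_eqVlt => /predU1P[->//|xy].
  exact/ltW/f_incr.
have [I0 I1] : (0 : R) \in `[-1, 1] /\ (1 : R) \in `[-1, 1].
  by split; apply: I01; rewrite ?lexx ?ler01.
have [C1 f1] := fAC _ I1; rewrite expr1n mul1r in C1 f1.
have f0 : f 0 = 0.
  by have := f_odd _ I0; rewrite oppr0 => /eqP; rewrite -addr_eq0 -mulr2n mulrn_eq0 => /eqP.
have A1 : 0 < A.[1] by rewrite -f1 mulr_gt0// -f0 f_incr// ltr01.
have := slope_bound n_ge1 sA sC C_gt0 mono A1.
by rewrite (derive1_odd_quotient fAC) -f1 mulfK ?gt_eqF.
Qed.
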